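(* Let $L:(I,q)\to\mathbb{P}(\mathcal{L})$ be a closed polarised curve of finite type that projects to a constrained elastic curve in some appropriate space form of sectional curvature $\kappa$, with $q$ the arc-length polarisation of that space form. Then $L$ admits a resonance point on some multiple cover of $L$, where the resonance point $\mu$ satisfies $$\mu>-\frac{\kappa}{2}.$$
   Context: $\mathbb{R}^{3,1}$ is $\mathbb{R}^4$ with a symmetric bilinear form $(\cdot,\cdot)$ of signature $(-+++)$; $\mathcal{L}=\{X\in\mathbb{R}^{3,1}:(X,X)=0\}$ is the lightcone, and $\mathbb{P}(\mathcal{L})$ is its projectivisation (the lines $\langle X\rangle$ with $0\neq X\in\mathcal{L}$), the conformal $2$-sphere. For $x,y\in\mathbb{R}^{3,1}$, $x\wedge y\in\mathfrak{o}(3,1)$ is the map $(x\wedge y)v=(x,v)y-(y,v)x$. Polarised curve: $I$ is an open interval (for closed curves identified with the universal cover $\mathbb{R}$), $q$ is a non-vanishing quadratic differential on $I$, i.e. $q=\frac1m\,\mathrm{d}s^2$ in a coordinate $s$ with $m$ a non-vanishing real function, and $L:(I,q)\to\mathbb{P}(\mathcal{L})$ is a (smooth) regular curve, regarded as a line subbundle of $I\times\mathbb{R}^{3,1}$ with sections $\Gamma L$. $L$ is closed with period $T>0$ if $L$ and $q$ are $T$-periodic in $s$. Space form projection: for a constant vector $\mathfrak{q}\in\mathbb{R}^{3,1}$ with $(\mathfrak{q},\mathfrak{q})=-\kappa$, the set $M=\{X\in\mathcal{L}:(X,\mathfrak{q})=-1\}$ with the induced metric is a $2$-dimensional Riemannian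 space form of constant sectional curvature $\kappa$. $L$ projects to a curve in this space form if there is $X\in\Gamma L$ with $(X,\mathfrak{q})=-1$; the projected curve is $X:I\to M$. The arc-length polarisation of that space form is $q=(\mathrm{d}X,\mathrm{d}X)$ for this $X$. Constrained elastic curve: a curve in a $2$-dimensional space form which is a critical point of the bending energy (the integral of the squared geodesic curvature with respect to arc-length) under variations that fix length and enclosed area. Let $\eta=q\,\frac{X\wedge \mathrm{d}X}{(\mathrm{d}X,\mathrm{d}X)}$ for any nowhere vanishing $X\in\Gamma L$ (independent of the choice of $X$). For $\mu\in\mathbb{R}$ let $A^\mu:I\to\mathrm{SO}(3,1)$ solve $\frac{\mathrm{d}}{\mathrm{d}s}A^\mu=-\mu\,\eta(\partial_s)A^\mu$, $A^\mu(0)=\mathrm{id}$; the monodromy matrix is $\mathcal{M}^\mu:=A^\mu(T)$. Finite type: the set $\{\mu\in\mathbb{R}:\mathcal{M}^\mu\text{ is non-diagonalisable}\}$ is finite (''diagonalisable'' means over $\mathbb{C}$). Resonance point: a spectral parameter $\mu\in\mathbb{R}\setminus\{0\}$ such that $\mathcal{M}^\mu$ is diagonalisable with single eigenvalue $1$ of multiplicity $4$ (i.e. $\mathcal{M}^\mu=\mathrm{id}$). A resonance point on a multiple cover of $L$ is a $\mu\in\mathbb{R}\setminus\{0\}$ for which there is an integer $\ell\ge1$ with $(\mathcal{M}^\mu)^\ell=\mathrm{id}$. *)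

(* Defs.v *)
From HB Require Import structures.
From mathcomp Require Import all_boot all_order all_algebra.
From mathcomp Require Import all_classical all_reals all_analysis.
From mathcomp Require Import complex.

Set Implicit Arguments.
Unset Strict Implicit.
Unset Printing Implicit Defensive.
Import Order.TTheory GRing.Theory Num.Theory.
Import numFieldNormedType.Exports.
Local Open Scope classical_set_scope.
Local Open Scope ring_scope.

(* C^oo on D, intended for open D: all iterated directional derivatives exist
   and are continuous at every point of D. *)
Definition smooth_on (R : realType) (V W : normedModType R) (D : set V)
    (f : V -> W) : Prop :=
  forall (vs : seq V) (x : V), D x ->
    let g := foldr (fun v h => 'D_v h) f vs in
    {for x, continuous g} /\ forall v, derivable g x v.

Section Minkowski.
Variable R : realType.
Implicit Types x y v : 'cV[R]_4.

(* Gram matrix of the form of signature (-+++) in a standard basis. *)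
Definition lorentz_mx : 'M[R]_4 :=
  diag_mx (\row_(i < 4) if i == ord0 then -1 else 1).

Definition lform x y : R := (x^T *m lorentz_mx *m y) ord0 ord0.

(* The matrix of x /\ y; see wedgeE. *)
Definition wedge x y : 'M[R]_4 := (y *m x^T - x *m y^T) *m lorentz_mx.

Lemma wedgeE x y v : wedge x y *m v = lform x v *: y - lform y v *: x.
Proof.
rewrite /wedge /lform mulmxBl mulmxBl -!mulmxA.
rewrite [x^T *m _]mx11_scalar [y^T *m _]mx11_scalar !mul_mx_scalar.
by rewrite !mxE eqxx !mulr1n.
Qed.

Definition SO31 (A : 'M[R]_4) : Prop :=
  A^T *m lorentz_mx *m A = lorentz_mx /\ \det A = 1.

Definition lightcone : set 'cV[R]_4 := [set x | lform x x = 0].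

(* The points of P(lightcone), as 1-dimensional subspaces. *)
Definition null_line (l : {vspace 'cV[R]_4}) : Prop :=
  \dim l = 1%N /\ forall x, x \in l -> lightcone x.

End Minkowski.

Section PolarisedCurve.
Variable R : realType.
Implicit Types (L : R -> {vspace 'cV[R]_4}) (m : R -> R) (T : R).
Implicit Types (X : R -> 'cV[R]_4).

Definition smooth_regular_curve L : Prop :=
  (forall s, null_line (L s)) /\
  forall s0, exists (U : set R) (Y : R -> 'cV[R]_4),
    [/\ open U, U s0, smooth_on (U : set R^o) (Y : R^o -> 'cV[R]_4),
        forall s, U s -> L s = <[Y s]>%VS &
        forall s, U s -> derive1 Y s \notin L s].

(* The quadratic differential is q = ds^2 / m. *)
Definition polarised_curve L m : Prop :=
  [/\ smooth_regular_curve L,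
      smooth_on (setT : set R^o) (m : R^o -> R^o) &
      forall s, m s != 0].

Definition closed_with_period L m T : Prop :=
  [/\ 0 < T, forall s, L (s + T) = L s & forall s, m (s + T) = m s].

Definition section_of L X : Prop :=
  smooth_on (setT : set R^o) (X : R^o -> 'cV[R]_4) /\ forall s, X s \in L s.

(* eta(d/ds); for a nowhere vanishing section X it does not depend on X. *)
Definition eta m X (s : R) : 'M[R]_4 :=
  (m s)^-1 *: ((lform (derive1 X s) (derive1 X s))^-1
                 *: wedge (X s) (derive1 X s)).

Definition spectral_frame (et : R -> 'M[R]_4) (mu : R) (A : R -> 'M[R]_4) :
    Prop :=
  [/\ forall s, SO31 (A s),
      A 0 = 1%:M &
      forall s : R, is_derive (s : R^o) (1 : R^o) (A : R^o -> 'M[R]_4)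
        (- mu *: (et s *m A s))].

Definition monodromy (A : R -> R -> 'M[R]_4) T (mu : R) : 'M[R]_4 := A mu T.

Definition complex_diagonalizable (M : 'M[R]_4) : Prop :=
  diagonalizable (map_mx (real_complex R) M).

Definition finite_type (M : R -> 'M[R]_4) : Prop :=
  finite_set [set mu | ~ complex_diagonalizable (M mu)].

Definition resonance_on_multiple_cover (M : R -> 'M[R]_4) (mu : R) : Prop :=
  mu != 0 /\ exists l : nat, (1 <= l)%N /\ M mu ^+ l = 1%:M.

End PolarisedCurve.

Section SpaceForm.
Variable R : realType.
Variable qq : 'cV[R]_4.
Implicit Types (X g : R -> 'cV[R]_4) (T : R) (F : R -> R -> 'cV[R]_4).

Definition space_form : set 'cV[R]_4 :=
  [set x | lightcone x /\ lform x qq = -1].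

(* Orthogonal projection of R^{3,1} onto the tangent space at x of the space
   form, which is the orthogonal complement of the span of x and qq. *)
Definition tangent_proj (x v : 'cV[R]_4) : 'cV[R]_4 :=
  v + (lform v qq + lform qq qq * lform v x) *: x + lform v x *: qq.

(* Up to sign, the Riemannian area form at x: span(x, qq) has Gram determinant
   -1, so orthonormal tangent vectors u, v are sent to 1 or -1. *)
Definition area_form (x u v : 'cV[R]_4) : R :=
  \det (\matrix_(i < 4, j < 4) ([:: x; qq; u; v]`_j) i ord0 : 'M[R]_4).

Definition speed g (s : R) : R := Num.sqrt (lform (derive1 g s) (derive1 g s)).

Definition unit_tangent g (s : R) : 'cV[R]_4 := (speed g s)^-1 *: derive1 g s.

(* The Levi-Civita connection of the space form is the tangential part of
   the ambient derivative. *)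
Definition curvature_vector g (s : R) : 'cV[R]_4 :=
  (speed g s)^-1 *: tangent_proj (g s) (derive1 (unit_tangent g) s).

Definition curvature_sq g (s : R) : R :=
  lform (curvature_vector g s) (curvature_vector g s).

Definition curve_length T g : R :=
  \int[lebesgue_measure]_(s in `[0, T]) speed g s.

Definition bending_energy T g : R :=
  \int[lebesgue_measure]_(s in `[0, T]) (curvature_sq g s * speed g s).

(* F t s is a variation, with parameter t in ]-e, e[, of the closed curve X
   through regular closed curves of the space form. *)
Record closed_variation T X (e : R) F : Prop := ClosedVariation {
  variation_smooth :
    smooth_on [set p : R^o * R^o | `|p.1| < e]
      (fun p : R^o * R^o => F p.1 p.2);
  variation_base : forall s, F 0 s = X s;
  variation_space_form : forall t s, `|t| < e -> space_form (F t s);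
  variation_regular : forall t s, `|t| < e -> derive1 (F t) s != 0;
  variation_periodic : forall t s, `|t| < e -> F t (s + T) = F t s }.

(* The signed area swept out between the curves F t1 and F t2.  The enclosed
   area of a closed curve, possibly with self-intersections, is defined up to
   an additive constant by the requirement that this be its increment. *)
Definition swept_area T F (t1 t2 : R) : R :=
  \int[lebesgue_measure]_(t in `[t1, t2])
    \int[lebesgue_measure]_(s in `[0, T])
      area_form (F t s) (derive1 (F^~ s) t) (derive1 (F t) s).

Definition fixes_length T (e : R) F : Prop :=
  forall t, `|t| < e -> curve_length T (F t) = curve_length T (F 0).

Definition fixes_area T (e : R) F : Prop :=
  forall t1 t2, - e < t1 -> t1 <= t2 -> t2 < e -> swept_area T F t1 t2 = 0.

Definition constrained_elastic T X : Prop :=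
  forall (e : R) F, 0 < e -> closed_variation T X e F ->
    fixes_length T e F -> fixes_area T e F ->
    is_derive (0 : R^o) (1 : R^o)
      ((fun t => bending_energy T (F t)) : R^o -> R^o) 0.

Definition projects_to (L : R -> {vspace 'cV[R]_4}) X : Prop :=
  section_of L X /\ forall s, lform (X s) qq = -1.

Definition arc_length_polarisation (m : R -> R) X : Prop :=
  forall s, (m s)^-1 = lform (derive1 X s) (derive1 X s).

End SpaceForm.

(* Main.v *)
(* With the arc-length polarisation eta(d/ds) = X /\ X', and
   P(mu) = qq + mu X satisfies P' = - mu eta P.  As X is T-periodic, the
   monodromy M(mu) therefore fixes P(mu), and (P(mu), P(mu)) = - kappa - 2 mu is
   negative exactly when mu > - kappa / 2.  There M(mu) is a rotation, whose
   angle is determined by f(mu) = tr M(mu) = 2 + 2 cos(angle), and it is a root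
   of unity as soon as the angle is a rational multiple of 2 pi.  Now f is entire
   with f(0) = 4, so either f is not constant on mu > - kappa / 2, and by the
   intermediate value theorem it takes a value given by a rational angle, or
   f = 4 everywhere and M(mu) = id for every mu > - kappa / 2. *)
Require Import Defs.
From mathcomp Require Import all_boot all_order all_algebra.
From mathcomp Require Import all_classical all_reals all_analysis.
From mathcomp Require Import ring lra.
Import Order.TTheory GRing.Theory Num.Theory.
Import numFieldNormedType.Exports.
Local Open Scope classical_set_scope.
Local Open Scope ring_scope.

(** * Lorentz transformations fixing a timelike vector *)

Section Lorentz.
Variable R : realType.
Implicit Types (x y z p : 'cV[R]_4) (M N : 'M[R]_4).
Local Notation J := (lorentz_mx R).

Lemma tr_lorentz_mx : J^T = J. Proof. exact: tr_diag_mx. Qed.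

Lemma lorentz_mxK : J *m J = 1%:M.
Proof.
rewrite /lorentz_mx mul_diag_mx; apply/matrixP => i j; rewrite !mxE.
by case: (eqVneq i j) => [->|_]; case: ifP => _;
  rewrite ?mulr1n ?mulr0n ?mulrNN ?mulr1 ?mulr0.
Qed.

Lemma lformDl x y z : lform (x + y) z = lform x z + lform y z.
Proof. by rewrite /lform linearD !mulmxDl mxE. Qed.

Lemma lformZl (a : R) x y : lform (a *: x) y = a * lform x y.
Proof. by rewrite /lform linearZ /= -!scalemxAl mxE. Qed.

Lemma lformC x y : lform x y = lform y x.
Proof. by rewrite /lform -[LHS]mulr1n -[x^T *m _ *m y]trmxK [LHS]mxE
  !trmx_mul trmxK tr_lorentz_mx mulmxA. Qed.

Lemma lformDr x y z : lform z (x + y) = lform z x + lform z y.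
Proof. by rewrite !(lformC z) lformDl. Qed.

Lemma lformZr (a : R) x y : lform x (a *: y) = a * lform x y.
Proof. by rewrite !(lformC x) lformZl. Qed.

Lemma lformx0 x : lform x 0 = 0.
Proof. by rewrite -(scale0r 0) lformZr mul0r. Qed.

Lemma lformBl x y z : lform (x - y) z = lform x z - lform y z.
Proof. by rewrite lformDl -scaleN1r lformZl mulN1r. Qed.

Lemma lform_lorentz M x y : M^T *m J *m M = J ->
  lform (M *m x) (M *m y) = lform x y.
Proof.
by move=> MJ; rewrite /lform -{2}MJ trmx_mul !mulmxA.
Qed.

Lemma lform_sum x y : lform x y = \sum_i (if i == ord0 then -1 else 1) * (x i ord0 * y i ord0).
Proof.
rewrite /lform /lorentz_mx -mulmxA mul_diag_mx mxE; apply: eq_bigr => i _.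
by rewrite !mxE mulrCA.
Qed.

(** Reversed Cauchy-Schwarz. Write [x0], [p0] for the time coordinates: orthogonality makes [x0 p0]
    the Euclidean product of the spatial parts, so its square is at most [x0^2] times the squared
    spatial length of [p]. That length is below [p0^2], which forces [x0 = 0], and nullity then
    kills the spatial part. *)
Lemma orth_timelike_definite p x :
  lform p p < 0 -> lform x p = 0 -> lform x x = 0 -> x = 0.
Proof.
rewrite !lform_sum !big_ord_recl !big_ord0 /= => hp hxp hxx.
suff x0 : [/\ x ord0 ord0 = 0, x (lift ord0 ord0) ord0 = 0,
    x (lift ord0 (lift ord0 ord0)) ord0 = 0 &
    x (lift ord0 (lift ord0 (lift ord0 ord0))) ord0 = 0].
  case: x0 => a b c d; apply/colP => i; rewrite [RHS]mxE -[RHS]/(0 : R).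
  case: (unliftP ord0 i) => [j ->|->//]; case: (unliftP ord0 j) => [k ->|->//].
  by case: (unliftP ord0 k) => [l ->|->//]; rewrite (ord1 l).
move: hp hxp hxx.
move: (p ord0 ord0) (p (lift ord0 ord0) ord0)
  (p (lift ord0 (lift ord0 ord0)) ord0)
  (p (lift ord0 (lift ord0 (lift ord0 ord0))) ord0) => p0 p1 p2 p3.
move: (x ord0 ord0) (x (lift ord0 ord0) ord0)
  (x (lift ord0 (lift ord0 ord0)) ord0)
  (x (lift ord0 (lift ord0 (lift ord0 ord0))) ord0) => x0 x1 x2 x3.
rewrite !mul1r !mulN1r !addr0 => hp hxp hxx.
have hp' : p1 ^+ 2 + p2 ^+ 2 + p3 ^+ 2 < p0 ^+ 2 by nra.
have e1 : x0 ^+ 2 = x1 ^+ 2 + x2 ^+ 2 + x3 ^+ 2 by nra.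
have e2 : x0 * p0 = x1 * p1 + x2 * p2 + x3 * p3 by nra.
(* Cauchy-Schwarz, as Lagrange's identity *)
have h3 : x0 ^+ 2 * (p0 ^+ 2 - (p1 ^+ 2 + p2 ^+ 2 + p3 ^+ 2)) <= 0.
  rewrite (_ : _ * _ = - ((x1 * p2 - x2 * p1) ^+ 2 + (x1 * p3 - x3 * p1) ^+ 2
       + (x2 * p3 - x3 * p2) ^+ 2)); last first.
    by rewrite mulrBr -exprMn e2 e1; ring.
  by rewrite oppr_le0 !addr_ge0 ?sqr_ge0.
have x00 : x0 ^+ 2 = 0.
  apply/eqP; rewrite eq_le sqr_ge0 andbT.
  by rewrite -(pmulr_lle0 _ (_ : 0 < p0 ^+ 2 - (p1 ^+ 2 + p2 ^+ 2 + p3 ^+ 2))) ?subr_gt0.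
have := sqr_ge0 x1; have := sqr_ge0 x2; have := sqr_ge0 x3 => ? ? ?.
by split; apply/eqP; rewrite -sqrf_eq0; apply/eqP; lra.
Qed.

Lemma col_kernel n (N : 'M[R]_n) : \det N = 0 ->
  exists2 x : 'cV_n, x != 0 & N *m x = 0.
Proof.
rewrite -det_tr => /eqP/det0P[v v0 vN]; exists v^T; first by rewrite trmx_eq0.
by apply: trmx_inj; rewrite trmx_mul trmxK vN trmx0.
Qed.

Lemma horner_char_poly n (N : 'M[R]_n) (a : R) : (char_poly N).[a] = \det (a%:M - N).
Proof.
rewrite /char_poly -[LHS]/(horner_eval a _) -det_map_mx /char_poly_mx.
congr (\det _); apply/matrixP => i j.
by rewrite !mxE -[LHS]/(_.[a]) hornerD hornerN hornerMn hornerX hornerC.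
Qed.

(** * Spectrum of a Lorentz transformation with a fixed timelike vector *)

Section FixesTimelike.
Variables (M : 'M[R]_4) (p : 'cV[R]_4).
Hypotheses (MSO : SO31 M) (Mp : M *m p = p) (pT : lform p p < 0).
Let MJ : M^T *m J *m M = J. Proof. by case: MSO. Qed.
Let p0 : p != 0.
Proof.
by apply: contraTneq pT => ->; rewrite lformx0 ltxx.
Qed.

(* The vector [w = (M - 1) y] is orthogonal to [p] and, if fixed by [M], null. *)
Lemma fix_semisimple_col (y : 'cV[R]_4) :
  (M - 1%:M) *m ((M - 1%:M) *m y) = 0 -> (M - 1%:M) *m y = 0.
Proof.
set w := _ *m y => hw.
have wE : w = M *m y - y by rewrite /w mulmxBl mul1mx.
have Mw : M *m w = w.
  by apply/eqP; rewrite -subr_eq0 -{2}(mul1mx w) -mulmxBl hw.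
apply: (@orth_timelike_definite p) => //.
  by rewrite wE lformBl -{1}Mp lform_lorentz ?subrr.
by rewrite {1}wE lformBl -{1}Mw lform_lorentz ?subrr.
Qed.

Lemma fix_semisimple (N : 'M[R]_4) :
  (M - 1%:M) *m ((M - 1%:M) *m N) = 0 -> (M - 1%:M) *m N = 0.
Proof.
move=> h; apply/matrixP => i j; rewrite [RHS]mxE.
have := @fix_semisimple_col (N *m delta_mx j 0).
rewrite !mulmxA in h *; rewrite h mul0mx => /(_ erefl).
by rewrite -colE => /colP/(_ i); rewrite !mxE.
Qed.

(** Invariance of [J] makes [M^-1] conjugate to [M^T], so the characteristic polynomial is
    palindromic. Determinant, trace and the root [1] coming from [p] then determine all its
    coefficients. *)
Lemma char_poly_fix : char_poly M =
  ('X - 1) * (('X - 1) * ('X * 'X - (\tr M - 2)%:P * 'X + 1)).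
Proof.
have c0 : (char_poly M)`_0 = 1 by rewrite char_poly_det (proj2 MSO); ring.
have c3 := char_poly_trace M isT.
have c4 : (char_poly M)`_4 = 1.
  by have := char_poly_monic M; rewrite monicE lead_coefE size_char_poly => /eqP.
have ch u : (char_poly M).[u] = u ^+ 4 - \tr M * u ^+ 3 + (char_poly M)`_2 * u ^+ 2 +
   (char_poly M)`_1 * u + 1.
  rewrite horner_coef size_char_poly !big_ord_recr big_ord0 /= c4 c3 c0.
  by ring.
have detJ : \det J != 0.
  apply/eqP => d0; have := congr1 determinant lorentz_mxK.
  by rewrite det_mulmx d0 mul0r det1 => /esym/eqP; rewrite oner_eq0.
have recip u : u != 0 -> (char_poly M).[u] = u ^+ 4 * (char_poly M).[u^-1].
  move=> u0; rewrite !horner_char_poly.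
  have : M^T *m J *m (u%:M - M) = - u *: (u^-1%:M - M^T) *m J.
    rewrite mulmxBr MJ mul_mx_scalar -scalemxAl mulmxBl mul_scalar_mx scalerBr.
    by rewrite scalerA mulNr divff// scaleN1r scaleNr opprK addrC.
  move=> /(congr1 determinant); rewrite !det_mulmx detZ det_tr (proj2 MSO) mul1r.
  rewrite -[in RHS](tr_scalar_mx _ u^-1) -linearB /= det_tr mulrC => /(mulIf detJ) ->.
  by ring.
(* The row [p^T J] is fixed by right multiplication with [M], since [p^T J M = p^T M^T J M]. *)
have one : (char_poly M).[1] = 0.
  rewrite horner_char_poly; apply/eqP/det0P; exists (p^T *m J).
    apply: contra p0 => /eqP /(congr1 (mulmx^~ J)).
    by rewrite -mulmxA lorentz_mxK mulmx1 mul0mx => /eqP; rewrite trmx_eq0.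
  apply/eqP; rewrite mulmxBr mulmx1 subr_eq0; apply/eqP.
  by rewrite -{1}MJ -{2}Mp trmx_mul !mulmxA.
have c1 : (char_poly M)`_1 = - \tr M.
  (* The quadratic coefficient cancels from the reciprocity relation, so its instance at [2] already
     yields the linear one. *)
  have := recip 2; rewrite pnatr_eq0 => /(_ isT); rewrite !ch. lra.
have := one; rewrite !ch c1 => h.
have c2 : (char_poly M)`_2 = \tr M * 2 - 2 by lra.
rewrite -[LHS]coefK poly_def size_char_poly !big_ord_recr big_ord0 /=.
by rewrite c4 c3 c2 c1 c0 -!mul_polyC; ring.
Qed.

(** Otherwise the quadratic factor has a real root [l] with [l^2 != 1]. Invariance of the form makes
    its eigenvector both orthogonal to [p] and null, hence zero. *)
Lemma tr_fix_bound : `|\tr M - 2| <= 2.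
Proof.
rewrite leNgt; apply/negP => h.
have [l l0 l1] : exists2 l, l ^+ 2 - (\tr M - 2) * l + 1 = 0 & l ^+ 2 != 1.
  set c := \tr M - 2 in h *.
  have d0 : 0 < c ^+ 2 - 4.
    by rewrite -real_normK ?num_real//; nra.
  have r2 := sqr_sqrtr (ltW d0).
  have r0 : 0 < Num.sqrt (c ^+ 2 - 4) by rewrite sqrtr_gt0.
  move: (Num.sqrt _) r2 r0 => r r2 r0.
  exists ((c + r) / 2); first by nra.
  by apply/eqP => e; nra.
have [v v0 Mv] : exists2 v : 'cV_4, v != 0 & M *m v = l *: v.
  have [|v v0 hv] := @col_kernel _ (l%:M - M).
    rewrite -horner_char_poly char_poly_fix !(hornerE, hornerX).
    rewrite -[LHS]/((l - 1) * (l - 1) * (l * l - (\tr M - 2) * l + 1)).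
    by rewrite -(expr2 l) l0 mulr0.
  exists v => //; apply/eqP; rewrite eq_sym -subr_eq0 -mul_scalar_mx -mulmxBl.
  exact/eqP.
have l1' : l != 1 by apply: contra l1 => /eqP ->; rewrite expr1n.
case/eqP: v0; apply: (@orth_timelike_definite p) => //; apply/eqP.
  have h1 := lform_lorentz M v p MJ; rewrite Mp Mv lformZl in h1.
  have : (l - 1) * lform v p = 0 by rewrite mulrBl mul1r h1 subrr.
  by move=> /eqP; rewrite mulf_eq0 subr_eq0 (negPf l1').
have h1 := lform_lorentz M v v MJ; rewrite Mv lformZl lformZr mulrA -expr2 in h1.
have : (l ^+ 2 - 1) * lform v v = 0 by rewrite mulrBl mul1r h1 subrr.
by move=> /eqP; rewrite mulf_eq0 subr_eq0 (negPf l1).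
Qed.


(** Cayley-Hamilton gives this with [M - 1] squared; semisimplicity of the eigenvalue [1] removes
    one factor. *)
Lemma char_poly_fix_reduced :
  (M - 1%:M) *m (M *m M - (\tr M - 2) *: M + 1%:M) = 0.
Proof.
apply: fix_semisimple.
have -> : (M - 1%:M) *m ((M - 1%:M) *m (M *m M - (\tr M - 2) *: M + 1%:M)) =
   horner_mx M (char_poly M); last by rewrite Cayley_Hamilton.
rewrite char_poly_fix; move: (\tr M - 2) => d.
rewrite !(rmorphM, rmorphB, rmorphD, rmorph1) /= !horner_mx_X.
by rewrite !horner_mx_C -mul_scalar_mx.
Qed.

(** At trace 4 the quadratic factor is itself [(M - 1)^2], so [M - 1] is nilpotent, and
    semisimplicity lowers the exponent from 3 to 1. *)
Lemma trace4_fix : \tr M = 4 -> M = 1%:M.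
Proof.
move=> t4; have := char_poly_fix_reduced; rewrite t4.
have -> : (4 - 2 : R) = 2 by ring.
have -> : M *m M - (2 : R) *: M + 1%:M = (M - 1%:M) *m (M - 1%:M).
  rewrite mulmxBl !mulmxBr !mulmx1 !mul1mx scaler_nat opprB addrA mulr2n opprD.
  by rewrite -!addrA; congr (_ + (_ + _)); rewrite addrC.
move=> /fix_semisimple h; apply/eqP; rewrite -subr_eq0 -[_ - _]mulmx1; apply/eqP.
by apply: fix_semisimple; rewrite mulmx1.
Qed.

(* On the range of [M^2 - 2 cos(a) M + 1] the matrix [M] is the identity; on the
   complement its powers follow the Chebyshev recurrence. *)
Lemma rational_rotation_fix (a : R) (k l : nat) : 0 < a < pi ->
  a *+ l = pi *+ k.*2 -> \tr M = 2 + 2 * cos a -> M ^+ l = 1%:M.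
Proof.
move=> a0 ha tM.
have c1 : cos a < 1.
  by rewrite -[ltRHS]cos0 ltr_cos ?in_itv /= ?lexx ?pi_ge0 //; lra.
have s0 : sin a != 0 by rewrite gt_eqF// sin_gt0_pi.
have := char_poly_fix_reduced; rewrite (_ : \tr M - 2 = 2 * cos a); last first.
  by rewrite tM; ring.
set U := _ *m M - _ + _.
set c := cos a in c1 *.
move=> MU'.
have MU : M *m U = U by apply/eqP; rewrite -subr_eq0 -{2}[U]mul1mx -mulmxBl MU'.
(* From [M U = U] follows [U^2 = (2 - 2c) U], so [(2 - 2c)^-1 U] is a projection. [E] is the
   complementary one, annihilated by [U]. *)
pose E := 1%:M - (2 - 2 * c)^-1 *: U.
have c0 : 2 - 2 * c != 0 by apply/eqP; lra.
have QE : M *m (M *m E) = (2 * c) *: (M *m E) - E.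
  have UE : U *m E = 0.
    rewrite /E mulmxBr mulmx1 -scalemxAr {2}/U mulmxDl mulmxBl -mulmxA !MU.
    rewrite -scalemxAl MU mul1mx -/c (_ : U - (2 * c) *: U + U = (2 - 2 * c) *: U).
      by rewrite scalerA mulVf// scale1r subrr.
    by rewrite scalerBl scaler_nat mulr2n addrAC.
  apply/eqP; rewrite -subr_eq0 opprB addrA addrAC; apply/eqP.
  by rewrite -[RHS]UE /U mulmxDl mulmxBl mul1mx mulmxA -scalemxAl.
(* Sines solve the recurrence [QE]; writing the angle [(n - 1) a] as [a *+ n - a] lets the formula
   cover [n = 0]. *)
have ME n : sin a *: (M ^+ n *m E) = sin (a *+ n) *: (M *m E) - sin (a *+ n - a) *: E.
  elim: n => [|n IH].
    by rewrite expr0 mulr0n sin0 scale0r !sub0r sinN scaleNr opprK mul1mx.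
  rewrite exprS -mulmxA scalemxAr IH mulmxBr -!scalemxAr QE scalerBr scalerA.
  rewrite (mulrS a n) (addrC a) addrK [LHS]addrAC -scalerBl.
  congr (_ *: _ - _).
  by rewrite sinB sinD -/c; ring.
have sl : sin (a *+ l) = 0 /\ sin (a *+ l - a) = - sin a.
  have [sk ck] : sin (pi *+ k.*2) = 0 :> R /\ cos (pi *+ k.*2) = 1 :> R.
    have e : pi *+ k.*2 = 0 + (pi *+ 2) *+ k :> R by rewrite add0r -[RHS]mulrnA mul2n.
    by rewrite e (periodicn (@sinD2pi R)) (periodicn (@cosD2pi R)) sin0 cos0.
  by rewrite sinB ha sk ck mul0r mul1r sub0r.
have MEl : M ^+ l *m E = E.
  apply: (scalerI s0); rewrite ME (proj1 sl) (proj2 sl) scale0r sub0r scaleNr.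
  by rewrite opprK.
have MUn n : M ^+ n *m U = U.
  by elim: n => [|n IH]; rewrite ?mul1mx// exprS -mulmxA IH.
have <- : E + (2 - 2 * c)^-1 *: U = 1%:M by rewrite subrK.
rewrite -[LHS]mulmx1 -{1}(subrK ((2 - 2 * c)^-1 *: U) 1%:M) mulmxDr MEl.
by rewrite -scalemxAr MUn.
Qed.
End FixesTimelike.
End Lorentz.

(** * Taylor expansion of a linear differential equation in its parameter *)

Section Scalar.
Variable R : realType.
Implicit Types (f g : R -> R) (T c e : R).

Lemma continuous_primitive f T : 0 < T -> {within `[0, T], continuous f} ->
  let F x := \int[lebesgue_measure]_(t in `[0, x]) f t in
  [/\ F 0 = 0, {within `[0, T], continuous F} &
      forall x, x \in `]0, T[ -> is_derive x 1 F (f x)].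
Proof.
move=> T0 cf F.
have fi : lebesgue_measure.-integrable `[0, T] (EFin \o f).
  by apply: continuous_compact_integrable => //; exact: segment_compact.
split.
- by rewrite /F set_itv1 Rintegral_set1.
- exact: parameterized_integral_continuous (ltW T0) fi.
- move=> x xT; have := xT; rewrite in_itv => /andP[x0 xT'].
  have [|dF FE] := continuous_FTC1_closed xT' fi x0.
    exact: within_continuous_continuous T0 cf xT.
  by apply: DeriveDef => //; rewrite -derive1E.
Qed.

Lemma within_continuous_bounded f T : 0 < T -> {within `[0, T], continuous f} ->
  exists2 e, 0 <= e & forall s, s \in `[0, T] -> `|f s| <= e.
Proof.
move=> T0 cf.
have [|c _ h] := @EVT_max R (Num.norm \o f) 0 T (ltW T0).
  by apply: within_continuous_comp cf => x _; exact: norm_continuous.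
by exists `|f c| => // s sT; exact: h.
Qed.

(** The mean value theorem applied to [h - g] and [h + g], with [h] the claimed bound, replaces
    integration of [dg], which is not assumed continuous. *)
Lemma le_derive_pow g dg T c (N : nat) : 0 < T ->
  {within `[0, T], continuous g} -> g 0 = 0 ->
  (forall s, s \in `]0, T[ -> is_derive s 1 g (dg s)) ->
  (forall s, s \in `]0, T[ -> `|dg s| <= c * (s ^+ N / N`!%:R)) ->
  forall s, s \in `[0, T] -> `|g s| <= c * (s ^+ N.+1 / N.+1`!%:R).
Proof.
move=> T0 cg g0 Dg hdg s; rewrite in_itv /= => /andP[].
rewrite le_eqVlt => /predU1P[<- _|s0 sT].
  by rewrite g0 normr0 expr0n mul0r mulr0.
pose h (t : R) := c * (t ^+ N.+1 / N.+1`!%:R).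
have Dh (t : R) : is_derive t 1 h (c * (t ^+ N / N`!%:R)).
  have -> : h = (c / N.+1`!%:R) *: ((@id R) ^+ N.+1).
    by apply/funext => u; rewrite /h !fctE /GRing.scale /= -mulrA [in RHS](mulrC _^-1).
  have D1 := is_deriveZ (c / N.+1`!%:R) (is_deriveX N.+1 (is_derive_id t (1 : R))).
  apply: is_derive_eq D1 _; rewrite /GRing.scale /= mulr1 factS natrM.
  have Sn0 : N.+1%:R != 0 :> R by rewrite pnatr_eq0.
  have Fn0 : N`!%:R != 0 :> R by rewrite pnatr_eq0 -lt0n fact_gt0.
  move: (N.+1%:R : R) (N`!%:R : R) (t ^+ N) Sn0 Fn0 => a b d a0 b0.
  by field; rewrite a0 b0.
have Hh (sg : R) : `|sg| = 1 -> 0 <= h s - sg * g s.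
  move=> sg1; have tT t : t \in `]0, s[ -> t \in `]0, T[.
    by rewrite !in_itv /= => /andP[-> /lt_le_trans ->].
  have [t tI||t tI] := @MVT R (h - sg *: g)
    (fun t => c * (t ^+ N / N`!%:R) - sg * dg t) 0 s s0.
  - have Dg' := Dg _ (tT _ tI); exact: is_deriveB.
  - apply: (@continuous_subspaceW _ _ _ `[0, T]).
      by move=> x /=; rewrite !in_itv /= => /andP[-> /le_trans ->].
    apply: within_continuousB.
      apply: continuous_subspaceT => x.
      by apply/differentiable_continuous/derivable1_diffP; case: (Dh x).
    apply: (@within_continuous_comp _ _ _ _ g ( *%R sg)) cg => x _.
    exact: mulrl_continuous.
  rewrite !fctE g0 /GRing.scale /= mulr0 subr0 /h expr0n mul0r mulr0 !subr0 => ->.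
  apply: mulr_ge0 (ltW s0); rewrite subr_ge0 (le_trans (ler_norm _))//.
  by rewrite normrM sg1 mul1r hdg// tT.
rewrite ler_norml; apply/andP; split.
  by have := Hh (-1); rewrite normrN1 mulN1r opprK => /(_ erefl); rewrite /h; lra.
by have := Hh 1; rewrite normr1 mul1r subr_ge0 => /(_ erefl).
Qed.

Lemma exp_coeff_bound_eq0 (x D y : R) :
  (forall N, (0 < N)%N -> `|x| <= D * (y ^+ N / N`!%:R)) -> x = 0.
Proof.
move=> h; apply/eqP; rewrite -normr_le0 -(mulr0 D).
apply: (@ler_cvg_to _ \oo _ _ (fun=> `|x|) (fun N => D * exp_coeff y N)).
- exact: cvg_cst.
- by apply: cvgMr; exact: cvg_exp_coeff.
- by near=> N; apply: h; near: N; exact: nbhs_infty_gt.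
Unshelve. all: by end_near. Qed.

(* The remainder bound of an entire function of exponential type [W]; the second
   clause makes its constant uniform near [0]. *)
Definition taylor_expansion f (c : nat -> R) (W : R) :=
  (forall x, exists D, forall N,
     `|f x - \sum_(k < N) c k * x ^+ k| <= D * ((W * `|x|) ^+ N / N`!%:R)) /\
  exists D d, 0 < d /\ forall x N, `|x| < d ->
     `|f x - \sum_(k < N) c k * x ^+ k| <= D * ((W * `|x|) ^+ N / N`!%:R).

Lemma taylor_expansion0 f (c : nat -> R) W : taylor_expansion f c W -> c 0%N = f 0.
Proof.
move=> [/(_ 0)[D hD] _]; have := hD 1%N; rewrite big_ord1 expr0 mulr1 normr0 mulr0 expr1.
by rewrite mul0r mulr0 normr_le0 subr_eq0 => /eqP ->.
Qed.

(** An identity theorem. Near [0] the remainder of order [k + 2], divided by [t^(k+1)], forces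
    [c (k+1) = 0] by strong induction. With only [c 0] left, the remainder bound at a fixed [x]
    tends to [0]. *)
Lemma taylor_expansion_const f (c : nat -> R) W d : taylor_expansion f c W -> 0 < d ->
  (forall x, `|x| < d -> f x = f 0) -> forall x, f x = f 0.
Proof.
move=> fT d0 fc x; have c0 := taylor_expansion0 _ _ _ fT.
have [/(_ x)[Dx hx] [D [d' [d'0 hD]]]] := fT.
have cS k : c k.+1 = 0.
  elim/ltn_ind: k => k IH; apply/eqP; rewrite -normr_le0; apply/ler_addgt0Pl => e e0.
  rewrite addr0; set D' := `|D * (W ^+ k.+2 / k.+2`!%:R)| + 1.
  have D'0 : 0 < D' by rewrite ltr_wpDl.
  (* Halving keeps [t] strictly inside both radii, and [D' t <= e] is the bound wanted for
     [c k.+1]. *)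
  pose t := Num.min (Num.min d d' / 2) (e / D').
  have t0 : 0 < t by rewrite lt_min !divr_gt0// lt_min d0 d'0.
  have td : t < Num.min d d'.
    rewrite gt_min; apply/orP; left; rewrite ltr_pdivrMr// ltr_pMr ?ltr1n//.
    by rewrite lt_min d0 d'0.
  move: td; rewrite lt_min => /andP[td td'].
  have := hD t k.+2; rewrite (gtr0_norm t0) fc ?(gtr0_norm t0)// => /(_ td').
  rewrite big_ord_recr big_ord_recl big1 /=; last first.
    by move=> i _; rewrite IH ?mul0r// ltn_ord.
  rewrite expr0 mulr1 c0 addr0 opprD addrA subrr sub0r normrN normrM.
  rewrite (ger0_norm (exprn_ge0 _ (ltW t0))) exprMn (exprS t k.+1) => h.
  have h' : `|c k.+1| * t ^+ k.+1 <= (D' * t) * t ^+ k.+1.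
    apply: le_trans h _.
    rewrite (_ : D * _ = D * (W ^+ k.+2 / k.+2`!%:R) * t * t ^+ k.+1); last first.
      by move: (_^-1) (_ ^+ _) (_ ^+ _) => u v w; ring.
    rewrite ler_wpM2r ?exprn_ge0 ?(ltW t0)// ler_wpM2r ?(ltW t0)//.
    by rewrite (le_trans (ler_norm _))// lerDl.
  move: h'; rewrite ler_pM2r ?exprn_gt0// => /le_trans; apply.
  by rewrite -ler_pdivlMl// mulrC ge_min lexx orbT.
apply/eqP; rewrite -subr_eq0; apply/eqP.
apply: (@exp_coeff_bound_eq0 _ Dx (W * `|x|)) => -[//|N] _.
have := hx N.+1; rewrite big_ord_recl big1 /=; first by rewrite addr0 expr0 mulr1 c0.
by move=> i _; rewrite cS mul0r.
Qed.

(** At [N = 1] the remainder bound is [D W |t|], with [D] uniform near [0]. *)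
Lemma taylor_expansion_continuous f (c : nat -> R) W : taylor_expansion f c W ->
  {for 0, continuous f}.
Proof.
move=> fT; have c0 := taylor_expansion0 _ _ _ fT.
have [_ [D [d [d0 hD]]]] := fT.
apply/cvgrPdist_le => e e0; near=> t.
have D0 : 0 < `|D * W| + 1 by rewrite ltr_wpDl.
have td : `|t| < d by near: t; exists d => //= z; rewrite /= sub0r normrN.
have te : `|t| <= e / (`|D * W| + 1).
  near: t; exists (e / (`|D * W| + 1)) => [|z] /=; first exact: divr_gt0.
  by rewrite /= sub0r normrN => /ltW.
have := hD t 1%N td; rewrite big_ord1 expr0 mulr1 c0 expr1 divr1 mulrA distrC.
move=> /le_trans; apply; rewrite ler_pdivlMr// mulrC in te; apply: le_trans te.
by rewrite ler_wpM2r// (le_trans (ler_norm _))// lerDl.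
Unshelve. all: by end_near. Qed.
End Scalar.


(** * Picard iteration for [C' = x E C] and its remainder *)

Section Picard.
Variables (R : realType) (n : nat) (T : R) (E : R -> 'M[R]_n).
Hypothesis T0 : 0 < T.

Definition mx_within_continuous (F : R -> 'M[R]_n) :=
  forall i j, {within `[0, T], continuous (fun s => F s i j)}.

Definition mx_derive_on (F dF : R -> 'M[R]_n) :=
  forall i j s, s \in `]0, T[ -> is_derive s 1 (fun s => F s i j) (dF s i j).

Hypothesis cE : mx_within_continuous E.

Lemma mx_within_continuousM F G : mx_within_continuous F -> mx_within_continuous G ->
  mx_within_continuous (fun s => F s *m G s).
Proof.
move=> cF cG i j.
have -> : (fun s => (F s *m G s) i j) = \sum_k (fun s => F s i k * G s k j).
  by apply/funext => s; rewrite mxE fct_sumE.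
apply: (big_ind (fun f : R -> R => {within `[0, T], continuous f})).
- by apply: continuous_subspaceT => x; exact: cst_continuous.
- by move=> f g; exact: within_continuousD.
- by move=> k _ s; apply: continuousM; [exact: cF|exact: cG].
Qed.

Lemma mx_within_continuous_bounded F : mx_within_continuous F ->
  exists2 e, 0 <= e & forall s i j, s \in `[0, T] -> `|F s i j| <= e.
Proof.
move=> cF.
have /choice[b hb] (ij : 'I_n * 'I_n) : exists e, 0 <= e /\
    forall s, s \in `[0, T] -> `|F s ij.1 ij.2| <= e.
  by have [e e0 he] := within_continuous_bounded _ _ _ T0 (cF ij.1 ij.2); exists e.
have b0 ij : 0 <= b ij by have [] := hb ij.
exists (\sum_ij b ij); first exact: sumr_ge0.
move=> s i j sT; rewrite (bigD1 (i, j))//= (le_trans ((hb (i, j)).2 s sT))//.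
by rewrite lerDl sumr_ge0.
Qed.

(** The iterated integrals of [E], which are the coefficients of [x^k] in the ordered exponential
    solving [C' = x E C], [C 0 = 1]. *)
Fixpoint picard (k : nat) (s : R) : 'M[R]_n :=
  if k is k'.+1 then
    \matrix_(i, j) \int[lebesgue_measure]_(t in `[0, s]) (E t *m picard k' t) i j
  else 1%:M.

Lemma picardS k i j : (fun s => picard k.+1 s i j) =
  fun s => \int[lebesgue_measure]_(t in `[0, s]) (E t *m picard k t) i j.
Proof. by apply/funext => s; rewrite mxE. Qed.

Lemma picard_continuous k : mx_within_continuous (picard k).
Proof.
elim: k => [|k IH] i j; first by apply: continuous_subspaceT => x; exact: cst_continuous.
rewrite picardS.
by have [] := continuous_primitive _ _ _ T0 (mx_within_continuousM _ _ cE IH i j).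
Qed.

Lemma picard0 k : picard k.+1 0 = 0.
Proof.
apply/matrixP => i j; rewrite -[LHS]/((fun s => picard k.+1 s i j) 0) picardS [RHS]mxE.
by have [] := continuous_primitive _ _ _ T0
  (mx_within_continuousM _ _ cE (picard_continuous k) i j).
Qed.

Lemma picard_derive k : mx_derive_on (picard k.+1) (fun s => E s *m picard k s).
Proof.
move=> i j; rewrite picardS.
by have [] := continuous_primitive _ _ _ T0
  (mx_within_continuousM _ _ cE (picard_continuous k) i j).
Qed.

Definition picard_rem (C : R -> 'M[R]_n) x N s := C s - \sum_(k < N) x ^+ k *: picard k s.

Section Solution.
Variables (x : R) (C : R -> 'M[R]_n).
Hypotheses (cC : mx_within_continuous C) (C0 : C 0 = 1%:M).
Hypothesis DC : mx_derive_on C (fun s => x *: (E s *m C s)).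

Lemma picard_remS N s : picard_rem C x N.+1 s = picard_rem C x N s - x ^+ N *: picard N s.
Proof. by rewrite /picard_rem big_ord_recr /= opprD addrA. Qed.

Lemma picard_rem_entryS N i j : (fun s => picard_rem C x N.+1 s i j) =
  (fun s => picard_rem C x N s i j) - x ^+ N *: (fun s => picard N s i j).
Proof. apply/funext => s; by rewrite picard_remS mxE [X in _ + X]mxE [X in - X]mxE. Qed.

Lemma picard_rem_init : picard_rem C x 0 = C.
Proof. by apply/funext => s; rewrite /picard_rem big_ord0 subr0. Qed.

Lemma picard_rem_continuous N : mx_within_continuous (picard_rem C x N).
Proof.
elim: N => [|N IH] i j; first by rewrite picard_rem_init.
rewrite picard_rem_entryS; apply: within_continuousB; first exact: IH.
apply: (@within_continuous_comp _ _ _ _ (fun s => picard N s i j) ( *%R (x ^+ N))).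
  by move=> t _; exact: mulrl_continuous.
exact: picard_continuous.
Qed.

Lemma picard_rem0 N : picard_rem C x N.+1 0 = 0.
Proof.
rewrite /picard_rem big_ord_recl big1 => [|i _].
  by rewrite C0 expr0 scale1r addr0 subrr.
by rewrite (picard0 i) scaler0.
Qed.

Lemma picard_rem_derive N :
  mx_derive_on (picard_rem C x N.+1) (fun s => x *: (E s *m picard_rem C x N s)).
Proof.
elim: N => [|N IH] i j s sT.
  rewrite picard_rem_entryS picard_rem_init -[X in is_derive _ _ _ X]subr0.
  apply: is_deriveB (DC i j s sT) _; rewrite expr0 scale1r; exact: is_derive_cst.
have D1 := IH i j s sT; have D2 := is_deriveZ (x ^+ N.+1) (picard_derive N i j s sT).
rewrite picard_rem_entryS; apply: is_derive_eq (is_deriveB D1 D2) _.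
rewrite picard_remS [in RHS]mulmxBr [in RHS]scalerBr -scalemxAr scalerA -exprS.
by rewrite [RHS]mxE [X in _ = _ + X]mxE [X in _ = _ - X]mxE.
Qed.

(** Differentiation lowers the order of the remainder by one, so [le_derive_pow] iterated from the
    crude bound [D] produces the factorial. The factor [n] counts the terms in an entry of a matrix
    product. *)
Lemma picard_rem_le e D N : 
  (forall s i j, s \in `[0, T] -> `|E s i j| <= e) ->
  (forall s i j, s \in `[0, T] -> `|C s i j| <= D) ->
  forall s i j, s \in `[0, T] ->
    `|picard_rem C x N s i j| <= D * (`|x| * (n%:R * e)) ^+ N * (s ^+ N / N`!%:R).
Proof.
move=> he hD; elim: N => [|N IH] s i j sT.
  rewrite /picard_rem big_ord0 subr0 !expr0 divr1 !mulr1; exact: hD.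
apply: (le_derive_pow _ _ _ _ _ _ T0 (picard_rem_continuous N.+1 i j) _
  (picard_rem_derive N i j)) sT.
  by rewrite picard_rem0 mxE.
move=> t tT; have tT' : t \in `[0, T].
  by move: tT; rewrite !in_itv /= => /andP[/ltW -> /ltW ->].
have t0 : 0 <= t by move: tT'; rewrite in_itv /= => /andP[].
rewrite mxE normrM mxE.
rewrite exprS (_ : D * (_ * _) * _ = `|x| *
  \sum_(k < n) e * (D * (`|x| * (n%:R * e)) ^+ N * (t ^+ N / N`!%:R))); last first.
  rewrite sumr_const card_ord -[X in _ = _ * X]mulr_natl.
  by move: (_ ^+ N) (_ / _) => u v; ring.
rewrite ler_wpM2l// (le_trans (ler_norm_sum _ _ _))// ler_sum// => k _.
by rewrite normrM ler_pM// ?he ?IH.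
Qed.

(* Bootstrapping: a bound [D] on [C] improves to [1 + D / 2]. *)
Lemma solution_le2 e : 0 <= e ->
  (forall s i j, s \in `[0, T] -> `|E s i j| <= e) ->
  `|x| * (n%:R * e) * T <= 2^-1 ->
  forall s i j, s \in `[0, T] -> `|C s i j| <= 2.
Proof.
move=> e0 he hx s i j sT.
(* Bootstrapping the least bound [sup S], finite by compactness, gives [sup S <= 1 + sup S / 2],
   that is [sup S <= 2]. *)
pose S := [set r | exists s i j, s \in `[0, T] /\ r = `|C s i j|].
have [D0 D00 hD0] := mx_within_continuous_bounded _ cC.
have Sub : has_ubound S by exists D0 => _ [u [k [l [uT ->]]]]; exact: hD0.
have hD u k l : u \in `[0, T] -> `|C u k l| <= sup S.
  by move=> uT; apply: ub_le_sup => //; exists u, k, l.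
have D_ge0 : 0 <= sup S by apply: le_trans (hD s i j sT).
suff : sup S <= 1 + sup S / 2 by have := hD s i j sT; lra.
apply: ge_sup => [|_ [u [k [l [uT ->]]]]]; first by exists `|C s i j|, s, i, j.
have /andP[u0 uT'] : 0 <= u <= T by rewrite in_itv in uT.
have := picard_rem_le e (sup S) 1 he hD u k l uT.
rewrite /picard_rem big_ord1 expr0 scale1r expr1 divr1 /= => h.
have -> : C u k l = (1%:M : 'M[R]_n) k l + (C u - 1%:M) k l.
  by rewrite [X in _ + X]mxE [X in _ + (_ + X)]mxE addrC subrK.
rewrite (le_trans (ler_normD _ _))// lerD//.
  by rewrite mxE; case: (k == l); rewrite ?normr1 ?normr0.
rewrite (le_trans h)// -mulrA ler_wpM2l// (le_trans _ hx)//.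
by rewrite ler_wpM2l// !mulr_ge0.
Qed.

End Solution.

Section Family.
Variable C : R -> R -> 'M[R]_n.
Hypotheses (cC : forall x, mx_within_continuous (C x)) (C0 : forall x, C x 0 = 1%:M).
Hypothesis DC : forall x, mx_derive_on (C x) (fun s => x *: (E s *m C x s)).

(** At a fixed [x], a bound on the continuous [C x] supplies the constant. Near [0] the uniform
    bound 2 of [solution_le2] replaces it. *)
Lemma solution_trace_taylor (B : 'M[R]_n) : exists W,
  taylor_expansion R (fun x => \tr (B *m C x T)) (fun k => \tr (B *m picard k T)) W.
Proof.
have [e e0 he] := mx_within_continuous_bounded _ cE.
have TT : T \in `[0, T] by rewrite in_itv /= lexx ltW.
pose b := \sum_(i < n) \sum_(j < n) `|B i j|.
have trB (Z : 'M[R]_n) (z : R) : (forall i j, `|Z i j| <= z) -> `|\tr (B *m Z)| <= b * z.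
  move=> hZ; rewrite /mxtrace mulr_suml (le_trans (ler_norm_sum _ _ _))//.
  apply: ler_sum => i _; rewrite mxE mulr_suml (le_trans (ler_norm_sum _ _ _))//.
  by apply: ler_sum => j _; rewrite normrM ler_wpM2l.
exists (n%:R * e * T).
have key x D N : (forall s i j, s \in `[0, T] -> `|C x s i j| <= D) ->
  `|\tr (B *m C x T) - \sum_(k < N) \tr (B *m picard k T) * x ^+ k| <=
    b * D * ((n%:R * e * T * `|x|) ^+ N / N`!%:R).
  move=> hD.
  have -> : \tr (B *m C x T) - \sum_(k < N) \tr (B *m picard k T) * x ^+ k =
      \tr (B *m picard_rem (C x) x N T).
    rewrite /picard_rem mulmxBr [RHS]raddfB mulmx_sumr; congr (_ - _).
    rewrite raddf_sum.
    by apply: eq_bigr => k _; rewrite -scalemxAr [RHS]mxtraceZ mulrC.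
  have hR i j := picard_rem_le x (C x) (cC x) (C0 x) (DC x) _ _ N he hD T i j TT.
  apply: le_trans (trB _ _ hR) _.
  rewrite (_ : n%:R * e * T * `|x| = `|x| * (n%:R * e) * T); last by ring.
  rewrite (exprMn N _ T); move: (_ ^+ N) (_ ^+ N) (_^-1) => u v w.
  by rewrite -!mulrA.
split=> [x|].
  have [D D0 hD] := mx_within_continuous_bounded _ (cC x).
  by exists (b * D) => N; exact: key hD.
have W0 : 0 <= n%:R * e * T by rewrite !mulr_ge0// ltW.
(* The radius is chosen to give [|x| n e T <= 1/2]; the [+ 1] keeps its denominator positive even if
   [e = 0]. *)
exists (b * 2), (2 * (n%:R * e * T + 1))^-1; split=> [|x N hx].
  by rewrite invr_gt0 mulr_gt0// ltr_wpDl.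
apply: key; apply: (solution_le2 x (C x) _ _ _ e e0 he) => //.
rewrite -mulrA; apply: (@le_trans _ _ (`|x| * (n%:R * e * T + 1))).
  by rewrite ler_wpM2l// lerDl.
move: hx; rewrite invfM => /ltW hx.
by rewrite -ler_pdivlMr// ltr_wpDl.
Qed.
End Family.
End Picard.

(** * Spectral frames *)

Section EntrywiseDerivative.
Variable R : realType.

Definition mx_is_derive m n (s : R) (F : R -> 'M[R]_(m, n)) (dF : 'M[R]_(m, n)) :=
  forall i j, is_derive s 1 (fun t => F t i j) (dF i j).

Lemma is_derive_mx_entry m n (s : R) (F : R -> 'M[R]_(m, n)) dF :
  is_derive (s : R^o) (1 : R^o) (F : R^o -> 'M[R]_(m, n)) dF -> mx_is_derive m n s F dF.
Proof.
case=> DF <- i j; rewrite derive_mx// mxE; apply: derivableP.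
by move/derivable_mxP : DF; apply.
Qed.

Lemma derivable_mx_is_derive m n (s : R) (F : R -> 'M[R]_(m, n)) :
  derivable (F : R^o -> 'M[R]_(m, n)) s 1 -> mx_is_derive m n s F (derive1 F s).
Proof. by move=> DF; apply: is_derive_mx_entry; rewrite derive1E; exact: derivableP. Qed.

Lemma mx_is_derive_unique m n (s : R) F dF dG :
  mx_is_derive m n s F dF -> mx_is_derive m n s F dG -> dF = dG.
Proof.
move=> h1 h2; apply/matrixP => i j.
by have [_ <-] := h1 i j; have [_ <-] := h2 i j.
Qed.

Lemma mx_is_derive_cst m n (s : R) A : mx_is_derive m n s (fun=> A) 0.
Proof. by move=> i j; rewrite mxE; exact: is_derive_cst. Qed.

Lemma mx_is_deriveD m n (s : R) F G dF dG : mx_is_derive m n s F dF ->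
  mx_is_derive m n s G dG -> mx_is_derive m n s (fun t => F t + G t) (dF + dG).
Proof.
move=> hF hG i j; rewrite mxE.
have -> : (fun t => (F t + G t) i j) = (fun t => F t i j) + (fun t => G t i j).
  by apply/funext => t; rewrite mxE.
exact: is_deriveD.
Qed.

Lemma mx_is_deriveT m n (s : R) F dF : mx_is_derive m n s F dF ->
  mx_is_derive n m s (fun t => (F t)^T) dF^T.
Proof.
move=> hF i j; rewrite mxE.
have -> : (fun t => (F t)^T i j) = (fun t => F t j i) by apply/funext => t; rewrite mxE.
exact: hF.
Qed.

Lemma mx_is_deriveM m n p (s : R) F G dF dG : mx_is_derive m n s F dF ->
  mx_is_derive n p s G dG ->
  mx_is_derive m p s (fun t => F t *m G t) (dF *m G s + F s *m dG).
Proof.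
move=> hF hG i j.
have -> : (fun t => (F t *m G t) i j) = \sum_k ((fun t => F t i k) * (fun t => G t k j)).
  by apply/funext => t; rewrite mxE fct_sumE.
have hk k : is_derive s 1 ((fun t => F t i k) * (fun t => G t k j))
    (F s i k *: dG k j + G s k j *: dF i k) by exact: is_deriveM.
apply: is_derive_eq (is_derive_sum hk) _.
rewrite !mxE -big_split; apply: eq_bigr => k _.
by rewrite addrC /GRing.scale /= (mulrC (G s k j)).
Qed.

Lemma mx_is_deriveMl m n p (s : R) (A : 'M[R]_(m, n)) G dG : mx_is_derive n p s G dG ->
  mx_is_derive m p s (fun t => A *m G t) (A *m dG).
Proof.
by move=> /(mx_is_deriveM _ _ _ _ _ _ _ _ (mx_is_derive_cst _ _ _ A)); rewrite mul0mx add0r.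
Qed.

Lemma mx_is_derive0_cst m n F : (forall s, mx_is_derive m n s F 0) -> forall s t, F s = F t.
Proof.
move=> h s t; apply/matrixP => i j.
apply: (@is_derive_0_is_cst _ (fun s => F s i j)) => u.
by have := h u i j; rewrite mxE.
Qed.

Lemma mx_is_derive_continuous m n F (dF : R -> 'M[R]_(m, n)) i j :
  (forall s, mx_is_derive m n s F (dF s)) -> continuous (fun s => F s i j).
Proof.
move=> h s; apply/differentiable_continuous/derivable1_diffP.
by case: (h s i j).
Qed.

End EntrywiseDerivative.

(** * Fixed vectors of the monodromy and expansion of its trace *)

Section SpectralFrame.
Variables (R : realType) (T : R) (W : R -> 'M[R]_4) (A : R -> R -> 'M[R]_4).
Local Notation J := (lorentz_mx R).
Hypothesis T0 : 0 < T.
Hypothesis cW : forall i j, continuous (fun s => W s i j).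
Hypothesis WJ : forall s, (W s)^T *m J = - (J *m W s).
Hypothesis hA : forall mu, spectral_frame W mu (A mu).

Lemma frame_derive mu s : mx_is_derive R 4 4 s (A mu) (- mu *: (W s *m A mu s)).
Proof. by apply: is_derive_mx_entry; have [_ _] := hA mu. Qed.

Lemma frame_lorentz mu s : (A mu s)^T *m J *m A mu s = J.
Proof. by have [/(_ s)[]] := hA mu. Qed.

Lemma frame_inv mu s : A mu s *m (J *m (A mu s)^T *m J) = 1%:M.
Proof. by apply: mulmx1C; rewrite -!mulmxA (mulmxA _^T) frame_lorentz lorentz_mxK. Qed.

(** As [W] is skew for [J], the product [A^T J P] is constant. Comparing its values at [0] and [T]
    and cancelling [A^T J] by invariance of the form gives the fixed vector. *)
Lemma frame_fix mu P : (forall s, mx_is_derive R 4 1 s P (- mu *: (W s *m P s))) ->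
  P T = P 0 -> A mu T *m P T = P T.
Proof.
move=> hP PT.
have cst : (A mu T)^T *m (J *m P T) = (A mu 0)^T *m (J *m P 0).
  apply: (@mx_is_derive0_cst _ _ _ (fun s => (A mu s)^T *m (J *m P s))) => s.
  have := mx_is_deriveM _ _ _ _ _ _ _ _ _ (mx_is_deriveT _ _ _ _ _ _ (frame_derive mu s))
     (mx_is_deriveMl _ _ _ _ _ J _ _ (hP s)).
  congr (mx_is_derive _ _ _ _ _ _).
  rewrite linearZ /= trmx_mul -scalemxAr -scalemxAr -scalemxAl -scalerDr -mulmxA.
  by rewrite (mulmxA (W s)^T) WJ mulNmx mulmxN -(mulmxA J) addNr scaler0.
have [_ A0 _] := hA mu.
have : (A mu T)^T *m J *m (A mu T *m P T) = (A mu T)^T *m J *m P T.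
  by rewrite mulmxA frame_lorentz -mulmxA cst A0 trmx1 mul1mx PT.
move=> /(congr1 (mulmx (A mu T *m J))).
by have := frame_inv mu T; rewrite !mulmxA => ->; rewrite !mul1mx.
Qed.

Lemma frame0 s : A 0 s = 1%:M.
Proof.
have [_ <- _] := hA 0; apply: mx_is_derive0_cst => {}s.
by have := frame_derive 0 s; rewrite oppr0 scale0r.
Qed.

(* [C x = (A mu0)^-1 A (mu0 - x)] solves [C' = x E C] with [E] independent of [x],
   so the expansion about any [mu0] is a Picard expansion at [x = 0]. *)
Lemma frame_trace_taylor mu0 : exists c V,
  taylor_expansion R (fun x => \tr (A (mu0 - x) T)) c V.
Proof.
pose B := A mu0.
(* [J B^T J] inverts [B] because [B] preserves [J]. *)
have [Binv BinvE] : {f : R -> 'M[R]_4 | f = fun s => J *m (B s)^T *m J} by eexists.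
have BBinv s : B s *m Binv s = 1%:M by rewrite BinvE frame_inv.
pose C x s := Binv s *m A (mu0 - x) s.
pose E s := Binv s *m W s *m B s.
have cA mu i j : continuous (fun s => A mu s i j).
  by apply: mx_is_derive_continuous => s; exact: frame_derive.
have dBinv s : mx_is_derive R 4 4 s Binv (mu0 *: (Binv s *m W s)).
  rewrite BinvE; have := mx_is_deriveM _ _ _ _ _ _ _ _ _ (mx_is_deriveMl _ _ _ _ _ J _ _
    (mx_is_deriveT _ _ _ _ _ _ (frame_derive mu0 s))) (mx_is_derive_cst _ _ _ s J).
  congr (mx_is_derive _ _ _ _ _ _); rewrite mulmx0 addr0 linearZ /= trmx_mul.
  rewrite -scalemxAr -scalemxAl scaleNr -scalerN; congr (_ *: _).
  by rewrite -!mulmxA WJ !mulmxN opprK.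
have dC x s : mx_is_derive R 4 4 s (C x) (x *: (E s *m C x s)).
  have := mx_is_deriveM _ _ _ _ _ _ _ _ _ (dBinv s) (frame_derive (mu0 - x) s).
  congr (mx_is_derive _ _ _ _ _ _).
  rewrite /E /C -!mulmxA (mulmxA (B s)) BBinv mul1mx -scalemxAl -mulmxA -scalemxAr -scalerDl.
  by congr (_ *: _); ring.
have cE : mx_within_continuous R 4 T E.
  apply: mx_within_continuousM => [|i j].
    apply: mx_within_continuousM => i j; apply: continuous_subspaceT.
      by apply: mx_is_derive_continuous; exact: dBinv.
    exact: cW.
  by apply: continuous_subspaceT; exact: cA.
have cC x : mx_within_continuous R 4 T (C x).
  by move=> i j; apply: continuous_subspaceT; apply: mx_is_derive_continuous; exact: dC.
have C0 x : C x 0 = 1%:M.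
  rewrite /C BinvE /B; have [_ -> _] := hA mu0; have [_ -> _] := hA (mu0 - x).
  by rewrite trmx1 !mulmx1 lorentz_mxK.
have [V hV] := solution_trace_taylor _ _ _ _ T0 cE C cC C0 (fun x i j s _ => dC x s i j) (B T).
eexists; exists V; rewrite (_ : (fun x => _) = (fun x => \tr (B T *m C x T))); first exact: hV.
by apply/funext => x; rewrite /C mulmxA BBinv mul1mx.
Qed.
End SpectralFrame.

(** * Curves in a space form *)

Section Wedge.
Variable R : realType.
Implicit Types (x y : 'cV[R]_4) (a b : R).
Local Notation J := (lorentz_mx R).

(** The effect of rescaling a section by a function with value [a] and derivative [b]: the [b] term
    disappears because [x /\ x = 0]. *)
Lemma wedge_gauge x y a b : wedge (a *: x) (b *: x + a *: y) = a ^+ 2 *: wedge x y.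
Proof.
rewrite /wedge scalemxAl; congr (_ *m _).
by apply/matrixP => i j; rewrite !mxE !big_ord1 !mxE; ring.
Qed.

(** This is membership of [x /\ y] in the Lie algebra o(3,1): its matrix is an antisymmetric one
    times [J]. *)
Lemma wedge_skew x y : (wedge x y)^T *m J = - (J *m wedge x y).
Proof.
have NT : (y *m x^T - x *m y^T)^T = - (y *m x^T - x *m y^T).
  by rewrite linearB /= !trmx_mul !trmxK opprB.
by rewrite /wedge trmx_mul NT tr_lorentz_mx mulmxN mulNmx -mulmxA.
Qed.

End Wedge.

Section SmoothCurve.
Variable R : realType.
Implicit Types (X Y : R -> 'cV[R]_4).

Lemma smooth_curve_derive X : smooth_on (setT : set R^o) (X : R^o -> 'cV[R]_4) ->
  forall s, mx_is_derive R 4 1 s X (derive1 X s).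
Proof.
by move=> sX s; apply: derivable_mx_is_derive; have [_] := sX [::] s I; apply.
Qed.

Lemma smooth_curve_derive_continuous X :
  smooth_on (setT : set R^o) (X : R^o -> 'cV[R]_4) ->
  forall i, continuous (fun s => derive1 X s i ord0).
Proof.
move=> sX i; apply: (@mx_is_derive_continuous _ 4 1 _ (derive1 (derive1 X)) i ord0) => s.
apply: derivable_mx_is_derive.
have [_ /(_ 1)] := sX [:: 1] s I; rewrite /=.
by have -> : derive1 X = 'D_1 (X : R^o -> 'cV[R]_4) by apply/funext => t; rewrite derive1E.
Qed.

Lemma lform_derive (s : R) X Y dX dY :
  mx_is_derive R 4 1 s X dX -> mx_is_derive R 4 1 s Y dY ->
  is_derive s 1 (fun t => lform (X t) (Y t)) (lform dX (Y s) + lform (X s) dY).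
Proof.
move=> hX hY.
have := mx_is_deriveM _ _ _ _ _ _ _ _ _ (mx_is_deriveT _ _ _ _ _ _ hX)
  (mx_is_deriveMl _ _ _ _ _ (lorentz_mx R) _ _ hY) ord0 ord0.
rewrite mxE !mulmxA; congr is_derive.
by apply/funext => t; rewrite mulmxA.
Qed.

Lemma lform_cst_derive (s a : R) X Y dX dY : (forall t, lform (X t) (Y t) = a) ->
  mx_is_derive R 4 1 s X dX -> mx_is_derive R 4 1 s Y dY ->
  lform dX (Y s) + lform (X s) dY = 0.
Proof.
move=> h hX hY; have [_ <-] := lform_derive _ _ _ _ _ hX hY.
by under eq_fun do rewrite h; rewrite derive_cst.
Qed.

Lemma wedge_continuous X : smooth_on (setT : set R^o) (X : R^o -> 'cV[R]_4) ->
  forall i j, continuous (fun s => wedge (X s) (derive1 X s) i j).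
Proof.
move=> sX i j.
have cX k : continuous (fun s => X s k ord0).
  exact: mx_is_derive_continuous (smooth_curve_derive _ sX).
have cX' := smooth_curve_derive_continuous _ sX.
have -> : (fun s => wedge (X s) (derive1 X s) i j) = (fun s =>
    (derive1 X s i ord0 * X s j ord0 - X s i ord0 * derive1 X s j ord0)
       * (if j == ord0 then -1 else 1)).
  apply/funext => s; rewrite /wedge /lorentz_mx mul_mx_diag !mxE !big_ord1 !mxE.
  by case: ifP.
move=> s; apply: cvgM; last exact: cvg_cst.
by apply: cvgB; apply: cvgM; [exact: cX'|exact: cX|exact: cX|exact: cX'].
Qed.

End SmoothCurve.

Lemma vline_scale (R : realType) (l : {vspace 'cV[R]_4}) x y :
  \dim l = 1%N -> x \in l -> x != 0 -> y \in l -> exists k, y = k *: x.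
Proof.
move=> l1 xl x0; suff -> : l = <[x]>%VS by move=> /vlineP.
by apply/eqP; rewrite eq_sym eqEdim -memvE xl l1 dim_vline x0.
Qed.

(** * The projected curve: periodicity, gauge and the conserved vector *)

Section Projection.
Variables (R : realType) (L : R -> {vspace 'cV[R]_4}) (m : R -> R) (T : R).
Variables (Y X : R -> 'cV[R]_4) (qq : 'cV[R]_4).
Hypotheses (hL : polarised_curve L m) (hT : closed_with_period L m T).
Hypotheses (hY : section_of L Y) (hY0 : forall s, Y s != 0).
Hypotheses (hX : projects_to qq L X) (hm : arc_length_polarisation m X).

Let sX : smooth_on (setT : set R^o) (X : R^o -> 'cV[R]_4).
Proof. by case: hX => -[]. Qed.
Let sY : smooth_on (setT : set R^o) (Y : R^o -> 'cV[R]_4).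
Proof. by case: hY. Qed.
Let XL s : X s \in L s. Proof. by case: hX => -[]. Qed.
Let Xq s : lform (X s) qq = -1. Proof. by case: hX. Qed.
Let X0 s : X s != 0.
Proof.
apply/eqP => e; have := Xq s; rewrite e lformC lformx0 => /eqP.
by rewrite eq_sym oppr_eq0 oner_eq0.
Qed.
Let L1 s : \dim (L s) = 1%N. Proof. by case: hL => -[/(_ s)[]]. Qed.

Lemma projection_null s : lform (X s) (X s) = 0.
Proof. by case: hL => -[/(_ s)[_ /(_ _ (XL s))]]. Qed.

Lemma projection_null_derive s : lform (X s) (derive1 X s) = 0.
Proof.
have dX := smooth_curve_derive _ _ sX s.
have := lform_cst_derive _ _ _ _ _ _ _ projection_null dX dX.
by rewrite (lformC _ (derive1 X s)) => h; lra.
Qed.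

Lemma projection_qq_derive s : lform (derive1 X s) qq = 0.
Proof.
have := lform_cst_derive _ _ _ _ _ _ _ Xq (smooth_curve_derive _ _ sX s)
  (mx_is_derive_cst _ _ _ s qq).
by rewrite lformx0 addr0.
Qed.

(** Both vectors span the same line, on which the normalisation against [qq] selects a single
    point. *)
Lemma projection_periodic s : X (s + T) = X s.
Proof.
case: hT => _ LT _.
have [|k Xk] := vline_scale _ _ (X s) (X (s + T)) (L1 s) (XL s) (X0 s).
  by rewrite -LT.
have := Xq (s + T); rewrite Xk lformZl Xq mulrN1 => /oppr_inj ->.
by rewrite scale1r.
Qed.

(** With [Y = f X], the wedge and [(Y', Y')] both scale by [f^2], so [f] cancels. The remaining
    [(X', X')] cancels against [m] because the polarisation is by arc length. *)
Lemma eta_projection s : eta m Y s = wedge (X s) (derive1 X s).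
Proof.
pose f (t : R) := - lform (Y t) qq.
have YX t : Y t = f t *: X t.
  have [|k Yk] := vline_scale _ _ (X t) (Y t) (L1 t) (XL t) (X0 t).
    by case: hY.
  by rewrite /f Yk lformZl Xq mulrN1 opprK.
have f0 : f s != 0 by apply: contra (hY0 s) => /eqP e; rewrite YX e scale0r.
pose f' : R := - lform (derive1 Y s) qq.
have Y' : derive1 Y s = f' *: X s + f s *: derive1 X s.
  have dX := smooth_curve_derive _ _ sX s.
  have dY := smooth_curve_derive _ _ sY s.
  have df : is_derive s 1 f f'.
    have := lform_derive _ _ _ _ _ _ dY (mx_is_derive_cst _ _ _ s qq).
    rewrite lformx0 addr0 => h.
    exact: is_deriveN.
  apply: (@mx_is_derive_unique _ _ _ s Y) => // i j.
  have -> : (fun t => Y t i j) = f * (fun t => X t i j).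
    by apply/funext => t; rewrite YX mxE.
  apply: is_derive_eq (is_deriveM df (dX i j)) _.
  by rewrite !mxE addrC /GRing.scale /= (mulrC (X s i j)).
have Y'Y' : lform (derive1 Y s) (derive1 Y s) = f s ^+ 2 * lform (derive1 X s) (derive1 X s).
  rewrite Y' !(lformDl, lformDr, lformZl, lformZr) projection_null.
  rewrite (lformC _ (derive1 X s)) projection_null_derive.
  by ring.
rewrite /eta Y'Y' Y' YX wedge_gauge !scalerA -hm.
case: hL => _ _ /(_ s) m0.
rewrite (_ : _ * _ = 1) ?scale1r//.
by field; rewrite m0 f0.
Qed.

(** [X /\ X'] kills [X], as [(X, X) = (X, X') = 0], and sends [qq] to [-X'], as [(X, qq) = -1] and
    [(X', qq) = 0]. *)
Lemma conserved_derive mu s : mx_is_derive R 4 1 s (fun t => qq + mu *: X t)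
  (- mu *: (wedge (X s) (derive1 X s) *m (qq + mu *: X s))).
Proof.
have := mx_is_deriveD _ _ _ _ _ _ _ _ (mx_is_derive_cst _ _ _ s qq)
   (mx_is_deriveMl _ _ _ _ _ (mu%:M) _ _ (smooth_curve_derive _ _ sX s)).
under [in X in X -> _]eq_fun do rewrite mul_scalar_mx.
rewrite mul_scalar_mx add0r; congr (mx_is_derive _ _ _ _ _ _).
rewrite mulmxDr -scalemxAr !wedgeE projection_null (lformC _ (derive1 X s) (X s)).
rewrite projection_null_derive Xq projection_qq_derive !scale0r subrr scaler0.
by rewrite subr0 addr0 scaleN1r scalerN scaleNr opprK.
Qed.

End Projection.

(** * Rational angles and the resonance point *)

Lemma rational_angle_between (R : realType) (a b : R) : 0 <= a -> a < b -> b <= pi ->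
  exists k l, (0 < l)%N /\ exists t, a < t < b /\ t *+ l = pi *+ k.*2.
Proof.
move=> a0 ab bpi; have pi0 := pi_gt0 R.
have pi2 : 0 < pi *+ 2 :> R by rewrite mulrn_wgt0.
have ab2 : a / (pi *+ 2) < b / (pi *+ 2) by rewrite ltr_pM2r ?invr_gt0.
(* Angles are measured in full turns; [q] is positive, so [k] and [l] are its numerator and
   denominator. *)
have [q] := rat_in_itvoo ab2; rewrite in_itv /= => /andP[aq qb].
have q0 : 0 < q.
  by rewrite -(ltr0q R) (le_lt_trans _ aq)// divr_ge0// ltW.
pose k := `|numq q|%N; pose l := `|denq q|%N; exists k, l.
split; first by rewrite absz_gt0 denq_neq0.
exists (ratr q * (pi *+ 2)); split.
  by rewrite -ltr_pdivrMr// aq -ltr_pdivlMr.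
have kE : (numq q)%:~R = `|numq q|%:R :> R.
  by rewrite -[in LHS](@gez0_abs (numq q)) ?numq_ge0 ?(ltW q0).
have lE : (denq q)%:~R = `|denq q|%:R :> R by rewrite -[in LHS](@gtz0_abs (denq q)).
have l0 : `|denq q|%:R != 0 :> R by rewrite pnatr_eq0 absz_eq0 denq_neq0.
rewrite /ratr kE lE -[LHS]mulr_natr (mulrAC _ (pi *+ 2)) divfK//.
by rewrite mulr_natl -[LHS]mulrnA mul2n.
Qed.

Theorem corollary4p7 (R : realType)
    (L : R -> {vspace 'cV[R]_4}) (m : R -> R) (T : R)
    (Y : R -> 'cV[R]_4) (A : R -> R -> 'M[R]_4)
    (qq : 'cV[R]_4) (kappa : R) (X : R -> 'cV[R]_4)
    (hL : polarised_curve L m)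
    (hT : closed_with_period L m T)
    (hY : section_of L Y) (hY0 : forall s, Y s != 0)
    (hA : forall mu, spectral_frame (eta m Y) mu (A mu))
    (hfin : finite_type (monodromy A T))
    (hkappa : lform qq qq = - kappa)
    (hX : projects_to qq L X)
    (hm : arc_length_polarisation m X)
    (hel : constrained_elastic qq T X) :
  exists mu : R,
    resonance_on_multiple_cover (monodromy A T) mu /\ - kappa / 2 < mu.
Proof.
have T0 : 0 < T by case: hT.
have sX : smooth_on (setT : set R^o) (X : R^o -> 'cV[R]_4) by case: hX => -[].
pose W s := wedge (X s) (derive1 X s).
have hW mu : spectral_frame W mu (A mu).
  have -> : W = eta m Y; last exact: hA.
  by apply/funext => s; rewrite (eta_projection _ _ _ _ _ _ hL hY hY0 hX hm).
have cW : forall i j, continuous (fun s => W s i j) by exact: wedge_continuous.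
have WJ s : (W s)^T *m lorentz_mx R = - (lorentz_mx R *m W s) by exact: wedge_skew.
pose M := monodromy A T; pose f mu := \tr (M mu).
pose p mu := qq + mu *: X T.
have MSO mu : SO31 (M mu) by have [/(_ T)] := hW mu.
have Mp mu : M mu *m p mu = p mu.
  apply: (frame_fix _ _ _ _ WJ hW mu (fun s => qq + mu *: X s)) => [s|].
    exact: conserved_derive hL hX mu s.
  by rewrite -{1}(add0r T) (projection_periodic _ _ _ _ _ _ hL hT hX).
have pT mu : - kappa / 2 < mu -> lform (p mu) (p mu) < 0.
  move=> hmu; rewrite /p !(lformDl, lformDr, lformZl, lformZr) hkappa.
  rewrite (projection_null _ _ _ _ _ hL hX) (lformC _ qq) (proj2 hX); lra.
have f0 : f 0 = 4 by rewrite /f /M /monodromy (frame0 _ _ _ hW) mxtrace1.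
have taylor := frame_trace_taylor _ _ _ _ T0 cW WJ hW.
have cf : continuous f.
  (* Continuity at [mu] is continuity at [0] of the expansion about [mu], in the variable
     [mu - y]. *)
  move=> mu; have [c [V /taylor_expansion_continuous h]] := taylor mu.
  rewrite (_ : f = (fun x => \tr (A (mu - x) T)) \o (fun y => mu - y)); last first.
    by apply/funext => y; rewrite /= subKr.
  apply: continuous_comp; last by rewrite subrr.
  by apply: cvgB; [exact: cvg_cst|exact: cvg_id].
have [fc|] := pselect (forall mu, - kappa / 2 < mu -> f mu = 4).
  (* Every parameter of the half-line has trivial monodromy here; this one is also nonzero. *)
  pose mu := Num.max (- kappa / 2) 0 + 1.
  have hmu : - kappa / 2 < mu by rewrite ltr_pwDr// le_max lexx.
  have mu0 : 0 < mu by rewrite ltr_pwDr// le_max lexx orbT.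
  exists mu; split => //; split; first by rewrite gt_eqF.
  exists 1%N; rewrite expr1; split => //.
  exact: trace4_fix (MSO mu) (Mp mu) (pT mu hmu) (fc mu hmu).
move=> /existsNP[mu0 /not_implyP[hmu0 fmu0]].
(* If [f] were constant on the half-line, the expansion about [mu0] would be constant within radius
   [mu0 + kappa / 2], hence everywhere. Evaluated at [x = mu0] it would give [f mu0 = f 0 = 4]. *)
have [mu1 hmu1 fmu1] : exists2 mu1, - kappa / 2 < mu1 & f mu1 <> f mu0.
  apply: contrapT => hc; apply: fmu0; rewrite -f0.
  have [c [V hV]] := taylor mu0.
  have d0 : 0 < mu0 - - kappa / 2 by rewrite subr_gt0.
  have := taylor_expansion_const _ _ _ _ _ hV d0.
  rewrite subr0 => /(_ _ mu0); rewrite subrr => h; apply/esym/h => x.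
  rewrite ltr_norml => /andP[_ hx]; apply: contrapT => fx; apply: hc.
  by exists (mu0 - x) => //; lra.
have [a [b [ha hb fab]]] : exists a b, [/\ - kappa / 2 < a, - kappa / 2 < b & f a < f b].
  case: (ltgtP (f mu0) (f mu1)) => [||/esym//] h; first by exists mu0, mu1.
  by exists mu1, mu0.
have ivt v : f a < v < f b -> exists2 mu, - kappa / 2 < mu & f mu = v.
  move=> /andP[av vb]; have cab c d : {within `[c, d], continuous f}.
    exact: continuous_subspaceT.
  (* Only [f a < f b] is known, so [a] and [b] may come in either order; the segment between them
     stays in the half-line. *)
  case: (leP a b) => ab.
    have [|mu + fmu] := IVT ab (cab a b) (v := v).
      by rewrite ge_min le_max (ltW av) (ltW vb) orbT.
    by rewrite in_itv /= => /andP[amu _]; exists mu => //; exact: lt_le_trans amu.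
  have [|mu + fmu] := IVT (ltW ab) (cab b a) (v := v).
    by rewrite ge_min le_max (ltW av) (ltW vb) orbT.
  by rewrite in_itv /= => /andP[bmu _]; exists mu => //; exact: lt_le_trans bmu.
have fbound mu : - kappa / 2 < mu -> -1 <= (f mu - 2) / 2 <= 1.
  move=> hmu; have := tr_fix_bound _ _ _ (MSO mu) (Mp mu) (pT mu hmu).
  by rewrite ler_norml -/(f mu) => /andP[? ?]; apply/andP; split; lra.
pose ang mu := acos ((f mu - 2) / 2).
have angI mu : - kappa / 2 < mu -> ang mu \in `[0, pi].
  by move=> /fbound h; rewrite in_itv /= acos_ge0// acos_lepi.
have cos_ang mu : - kappa / 2 < mu -> cos (ang mu) = (f mu - 2) / 2.
  by move=> /fbound h; rewrite acosK// in_itv.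
(* Cosine decreases on [[0, pi]], so the order of [a] and [b] is reversed. *)
have angba : ang b < ang a.
  by rewrite -ltr_cos ?angI// !cos_ang//; lra.
have angb0 : 0 <= ang b by have := angI b hb; rewrite in_itv => /andP[].
have angapi : ang a <= pi by have := angI a ha; rewrite in_itv => /andP[].
have [k [l [l0 [t [/andP[bt ta] tl]]]]] := rational_angle_between _ _ _ angb0 angba angapi.
have tI : t \in `[0, pi].
  by rewrite in_itv /= (le_trans angb0 (ltW bt)) (le_trans (ltW ta) angapi).
have [|mu hmu fmu] := ivt (2 + 2 * cos t).
  have : cos (ang a) < cos t by rewrite ltr_cos ?angI.
  have : cos t < cos (ang b) by rewrite ltr_cos ?angI.
  by rewrite !cos_ang// => ? ?; apply/andP; split; lra.
have t0 : 0 < t < pi by rewrite (le_lt_trans angb0 bt) (lt_le_trans ta angapi).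
exists mu; split => //; split.
  (* At [mu = 0] the trace 4 would force [cos t = 1], whereas [t] lies strictly between [0] and
     [pi]. *)
  apply/eqP => mu_0; move: fmu; rewrite mu_0 f0 => e.
  have : cos t < cos 0 by rewrite ltr_cos ?in_itv /= ?lexx ?pi_ge0//; case/andP: t0.
  by rewrite cos0; lra.
exists l; split => //.
exact: rational_rotation_fix (MSO mu) (Mp mu) (pT mu hmu) _ _ _ t0 tl fmu.
Qed.
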